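(* Let $M$ and $N$ be sets, let $c\in\mathbb{N}_1$ and let $T\colon\cup_c(M)\to\cup_1(N)$ be a function. Then the following are equivalent: (a) $T$ is a subsignal compatible transformation with dimensionality reduction constant $c$. (b) $T$ fulfills the dimensionality reduction property (with constant $c$), and for all $\xi\in\cup_c(M)$ and all $i\in\{1,\dots,\dim_M(\xi)-c+1\}$ it holds that $T(\mathrm{Subsignal}_c(\xi,i))=T(\xi)_i$. (c) There is a unique function $f\colon M^c\to N$ with $T=\mathrm{Slide}_f$.
   Context: $\mathbb{N}=\{0,1,2,\dots\}$, $\mathbb{N}_1=\mathbb{N}\setminus\{0\}$; $\{a,\dots,b\}$ is a set of integers (empty if $b<a$). For a set $M$ and $q\in\mathbb{N}_1$, elements of $M^q$ are called signals with $q$ samples; for $\xi\in M^q$, $\dim_M(\xi)=q$. For $c\in\mathbb{N}_1$, $\cup_c(M):=\bigcup_{q\ge c}M^q$. $M^1$ is identified with $M$. Subsignal extraction: for $d\in\mathbb{N}_1$, $\xi\in M^D$ with $D\ge d$ and $i\in\{1,\dots,D-d+1\}$, $\mathrm{Subsignal}_d(\xi,i):=(\xi_i,\xi_{i+1},\dots,\xi_{i+d-1})\in M^d$. A function $T\colon\cup_c(M)\to\cup_1(N)$ is a subsignal compatible transformation with dimensionality reduction constant $c\in\mathbb{N}_1$ iff (i) dimensionality reduction property: $\dim_N(T(\xi))=\dim_M(\xi)-c+1$ for all $\xi\in\cup_c(M)$; and (ii) exchange property: for all $d\in\mathbb{N}_1$, $d\ge c$, it holds that $T(\mathrm{Subsignal}_d(\xi,i))=\mathrm{Subsignal}_{d-c+1}(T(\xi),i)$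 for all $\xi\in\cup_d(M)$ and all $i\in\{1,\dots,\dim_M(\xi)-d+1\}$. For $f\colon M^c\to N$, $\mathrm{Slide}_f\colon\cup_c(M)\to\cup_1(N)$ is defined by $\mathrm{Slide}_f(\xi)\in N^{\dim_M(\xi)-c+1}$, $\mathrm{Slide}_f(\xi)_i:=f(\mathrm{Subsignal}_c(\xi,i))$ for $i\in\{1,\dots,\dim_M(\xi)-c+1\}$. *)

(* Defs.v *)
From mathcomp Require Import all_boot.

Set Implicit Arguments.
Unset Strict Implicit.
Unset Printing Implicit Defensive.

(* M^q is [q.-tuple M].  The union of the M^q for q >= c is the type of
   sequences with at least c entries; since the bound is boolean, two such
   signals are equal iff the underlying sequences are.
   All sample positions are counted from 0, so a range {1, ..., n} of indices
   becomes {0, ..., n - 1}. *)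
Definition cup (c : nat) (M : Type) : Type := {s : seq M | c <= size s}.

Definition dim (c : nat) (M : Type) (xi : cup c M) : nat := size (sval xi).

Definition samples (c : nat) (M : Type) (xi : cup c M) : (dim xi).-tuple M :=
  in_tuple (sval xi).

Fact cup_of_tuple_subproof (c q : nat) (M : Type) (h : c <= q)
  (t : q.-tuple M) : c <= size t.
Proof. by rewrite size_tuple. Qed.

(* The inclusion of M^q into the union, for q >= c. *)
Definition cup_of_tuple (c q : nat) (M : Type) (h : c <= q) (t : q.-tuple M) :
  cup c M := exist _ (tval t) (cup_of_tuple_subproof h t).

Fact subsignal_subproof (d D i : nat) (h : i + d <= D) (j : 'I_d) : i + j < D.
Proof. by apply: leq_trans h; rewrite ltn_add2l. Qed.

(* The condition [i + d <= D] says both that d <= D and that the (0-based)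
   position i lies in {0, ..., D - d}. *)
Definition subsignal (d D : nat) (M : Type) (xi : D.-tuple M) (i : nat)
  (h : i + d <= D) : d.-tuple M :=
  [tuple tnth xi (Ordinal (subsignal_subproof h j)) | j < d].

Fact window_subproof (c : nat) (M : Type) (xi : cup c M)
  (i : 'I_(dim xi - c + 1)) : i + c <= dim xi.
Proof.
have := ltn_ord i; rewrite [X in _ < X]addn1 ltnS.
by rewrite leq_subRL ?(svalP xi) // addnC.
Qed.

(* The subsignal with c samples at position i of a signal with at least c
   samples. *)
Definition window (c : nat) (M : Type) (xi : cup c M)
  (i : 'I_(dim xi - c + 1)) : c.-tuple M :=
  subsignal (samples xi) (window_subproof i).

Definition dim_reduction (c : nat) (M N : Type) (T : cup c M -> cup 1 N) :
  Prop := forall xi : cup c M, dim (T xi) = dim xi - c + 1.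

(* T(xi) as an element of N^(dim xi - c + 1). *)
Definition output (c : nat) (M N : Type) (T : cup c M -> cup 1 N)
  (hT : dim_reduction T) (xi : cup c M) : (dim xi - c + 1).-tuple N :=
  tcast (hT xi) (samples (T xi)).

Fact exchange_subproof (c d D i : nat) (hcd : c <= d) (h : i + d <= D) :
  i + (d - c + 1) <= D - c + 1.
Proof. by rewrite addnA leq_add2r addnBA // leq_sub2r. Qed.

Fact addn1_gt0 (n : nat) : 1 <= n + 1.
Proof. by rewrite addn1. Qed.

(* The right-hand side is only meaningful once T(xi) is known to have
   dim xi - c + 1 samples, hence the dependence on [hT].  A signal of
   dimension at least d is a [xi : cup c M] with d <= dim xi, which follows
   from [h]. *)
Definition exchange (c : nat) (M N : Type) (T : cup c M -> cup 1 N)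
  (hT : dim_reduction T) : Prop :=
  forall (d : nat) (hcd : c <= d) (xi : cup c M) (i : nat)
    (h : i + d <= dim xi),
    T (cup_of_tuple hcd (subsignal (samples xi) h)) =
    cup_of_tuple (addn1_gt0 (d - c))
      (subsignal (output hT xi) (exchange_subproof hcd h)).

(* [exists hT : P, Q hT] is a conjunction whose second component refers to the
   proof of the first. *)
Definition subsignal_compatible (c : nat) (M N : Type)
  (T : cup c M -> cup 1 N) : Prop :=
  exists hT : dim_reduction T, exchange hT.

Definition Slide (c : nat) (M N : Type) (f : c.-tuple M -> N) (xi : cup c M) :
  cup 1 N :=
  cup_of_tuple (addn1_gt0 (dim xi - c))
    [tuple f (window i) | i < dim xi - c + 1].

(* The identification of N with N^1. *)
Definition cup1 (N : Type) (y : N) : cup 1 N :=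
  cup_of_tuple (leqnn 1) [tuple y].

Definition window_compatible (c : nat) (M N : Type) (T : cup c M -> cup 1 N) :
  Prop :=
  exists hT : dim_reduction T,
    forall (xi : cup c M) (i : 'I_(dim xi - c + 1)),
      T (cup_of_tuple (leqnn c) (window i)) = cup1 (tnth (output hT xi) i).

(* Main.v *)
Require Import Defs.
From mathcomp Require Import all_boot.
From Stdlib Require Import FunctionalExtensionality.

(** In terms of the slices [take d (drop i s)], the window condition says that
    the one-sample slices of [T xi] are the values of [T] on the windows of
    [xi].  A signal is determined by its one-sample slices, and slices of slices
    are slices, so these values determine [T] (hence [T = Slide f], where [f] is
    the restriction of [T] to M^c) and the exchange property follows. *)

Lemma take_drop_take_drop (M : Type) (i j c d : nat) (s : seq M) :
  j + c <= d -> take c (drop j (take d (drop i s))) = take c (drop (i + j) s).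
Proof.
by rewrite addnC => h; rewrite take_drop take_takel // -take_drop drop_drop addnC.
Qed.

(** Comparing one-sample slices instead of [nth] values avoids a default element, so [M] may be
    empty. *)
Lemma eq_from_slice1 (M : Type) (s t : seq M) :
  size s = size t ->
  (forall i, i < size s -> take 1 (drop i s) = take 1 (drop i t)) -> s = t.
Proof.
elim: s t => [|x s IHs] [|y t] //= [st] slice_eq.
have /= := slice_eq 0 isT; rewrite !take0 => -[->].
by congr (_ :: _); apply: IHs => // i ilt; apply: (slice_eq i.+1).
Qed.

Lemma take1_drop_tuple (n : nat) (M : Type) (t : n.-tuple M) (i : 'I_n) :
  take 1 (drop i t) = [:: tnth t i].
Proof.
by rewrite (drop_nth (tnth_default t i)) ?size_tuple //= take0 -tnth_nth.
Qed.

Lemma cup_inj (c : nat) (M : Type) (xi eta : cup c M) :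
  sval xi = sval eta -> xi = eta.
Proof. exact: val_inj. Qed.

(** Passing to the underlying sequence removes the bound proofs carried by [subsignal]; slices of
    slices can then be computed. *)
Lemma subsignalE (d D : nat) (M : Type) (xi : D.-tuple M) (i : nat)
  (h : i + d <= D) : tval (subsignal xi h) = take d (drop i xi).
Proof.
have id_le : d <= size (drop i xi).
  by rewrite size_drop size_tuple leq_subRL // (leq_trans (leq_addr d i)).
apply: eq_from_slice1; first by rewrite size_tuple size_takel.
move=> j; rewrite size_tuple => jd.
rewrite (take1_drop_tuple _ _ _ (Ordinal jd)) tnth_mktuple.
by rewrite take_drop_take_drop ?addn1 // -take1_drop_tuple.
Qed.

Lemma windowE (c : nat) (M : Type) (xi : cup c M) (i : 'I_(dim xi - c + 1)) :
  tval (window i) = take c (drop i (sval xi)).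
Proof. exact: subsignalE. Qed.

Lemma outputE (c : nat) (M N : Type) (T : cup c M -> cup 1 N)
  (hT : dim_reduction T) (xi : cup c M) : tval (output hT xi) = sval (T xi).
Proof. exact: val_tcast. Qed.

(** Eliminates the cast in [output], which depends on the proof of [dim_reduction T]. *)
Lemma window_compatibleE (c : nat) (M N : Type) (T : cup c M -> cup 1 N) :
  window_compatible T <->
  dim_reduction T /\
  forall (xi : cup c M) (i : 'I_(dim xi - c + 1)),
    sval (T (cup_of_tuple (leqnn c) (window i))) =
    take 1 (drop i (sval (T xi))).
Proof.
split=> [[hT Tw]|[hT Tw]].
  by split=> // xi i; rewrite Tw /= -take1_drop_tuple outputE.
exists hT => xi i; apply: cup_inj.
by rewrite Tw /= -take1_drop_tuple outputE.
Qed.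

Lemma subsignal_compatible_window (c : nat) (M N : Type)
  (T : cup c M -> cup 1 N) : subsignal_compatible T -> window_compatible T.
Proof.
move=> [hT Tex]; apply/window_compatibleE; split=> // xi i.
(* This is the exchange property at [d = c], where the output slice has [c - c + 1 = 1] sample. *)
by rewrite /window Tex /= subsignalE outputE subnn.
Qed.

Lemma window_compatible_subsignal (c : nat) (M N : Type)
  (T : cup c M -> cup 1 N) : window_compatible T -> subsignal_compatible T.
Proof.
move=> /window_compatibleE[hT Tw]; exists hT => d hcd xi i h.
set eta := cup_of_tuple _ _; apply: cup_inj.
have dim_eta : dim eta = d by rewrite /dim size_tuple.
have size_T : size (sval (T eta)) = d - c + 1.
  by rewrite -[LHS]/(dim (T eta)) hT dim_eta.
apply: eq_from_slice1; first by rewrite size_T size_tuple.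
move=> j; rewrite size_T => jlt.
have jlt_eta : j < dim eta - c + 1 by rewrite dim_eta.
have jcd : j + c <= d by rewrite -dim_eta (window_subproof (Ordinal jlt_eta)).
(* Window [j] of the subsignal [eta] is window [i + j] of [xi]; it fits because [j + c <= d] and
   [i + d <= dim xi]. *)
have ijlt : i + j < dim xi - c + 1.
  rewrite addn1 ltnS leq_subRL ?(svalP xi) // addnC -addnA.
  by rewrite (leq_trans _ h) // leq_add2l.
(* The window condition is used twice: for [eta] at [j] on the left, then for [xi] at [i + j] on the
   right. Both sides become [T] of the same window. *)
rewrite -(Tw eta (Ordinal jlt_eta)) /= subsignalE outputE.
rewrite take_drop_take_drop; last by rewrite [X in X <= _]addn1.
rewrite -(Tw xi (Ordinal ijlt)); congr (sval (T _)); apply: cup_inj.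
by rewrite [LHS]windowE [RHS]windowE [sval eta]subsignalE take_drop_take_drop.
Qed.

(** With exactly [c] samples the only position is 0, and the window there is the whole signal. *)
Lemma window_id (c : nat) (M : Type) (t : c.-tuple M)
  (i : 'I_(dim (cup_of_tuple (leqnn c) t) - c + 1)) : window i = t.
Proof.
apply: val_inj; rewrite [LHS]windowE /=.
have : i < 1 by have := ltn_ord i; rewrite [X in _ < X - _ + _]size_tuple subnn.
by rewrite ltnS leqn0 => /eqP->; rewrite drop0 take_oversize ?size_tuple.
Qed.

Lemma Slide_slice1 (c : nat) (M N : Type) (f : c.-tuple M -> N) (xi : cup c M)
  (i : 'I_(dim xi - c + 1)) :
  take 1 (drop i (sval (Slide f xi))) = [:: f (window i)].
Proof. by rewrite take1_drop_tuple tnth_mktuple. Qed.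

Lemma dim_Slide (c : nat) (M N : Type) (f : c.-tuple M -> N) :
  dim_reduction (Slide f).
Proof. by move=> xi; rewrite [LHS]size_tuple. Qed.

(** Restricting [Slide f] to M^c recovers [f], which yields the uniqueness of [f]. *)
Lemma Slide_tuple (c : nat) (M N : Type) (f : c.-tuple M -> N)
  (t : c.-tuple M) : sval (Slide f (cup_of_tuple (leqnn c) t)) = [:: f t].
Proof.
set xi := cup_of_tuple _ _.
have dim_xi : dim xi - c + 1 = 1 by rewrite /dim size_tuple subnn.
have i_lt : 0 < dim xi - c + 1 by rewrite dim_xi.
rewrite -[in RHS](window_id _ _ t (Ordinal i_lt)) -Slide_slice1 [nat_of_ord _]/= drop0.
by rewrite take_oversize // size_tuple dim_xi.
Qed.

Lemma Slide_inj (c : nat) (M N : Type) (f g : c.-tuple M -> N) :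
  Slide f = Slide g -> f = g.
Proof.
move=> fg; apply: functional_extensionality => t.
by have := Slide_tuple _ _ _ f t; rewrite fg Slide_tuple => -[].
Qed.

Lemma window_compatible_Slide (c : nat) (M N : Type) (f : c.-tuple M -> N) :
  window_compatible (Slide f).
Proof.
apply/window_compatibleE; split=> [|xi i]; first exact: dim_Slide.
by rewrite Slide_tuple Slide_slice1.
Qed.

Lemma window_compatible_exists_Slide (c : nat) (M N : Type)
  (T : cup c M -> cup 1 N) :
  window_compatible T -> exists f : c.-tuple M -> N, T = Slide f.
Proof.
move=> /window_compatibleE[hT Tw].
have size_T t : size (sval (T (cup_of_tuple (leqnn c) t))) == 1.
  by rewrite -[size _]/(dim (T _)) hT /dim size_tuple subnn.
(* On M^c the output has exactly one sample, so [thead] reads it off without a default value. *)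
pose f t := thead (Tuple (size_T t)).
have Tf t : sval (T (cup_of_tuple (leqnn c) t)) = [:: f t].
  by rewrite /f -take1_drop_tuple drop0 take_oversize // (eqP (size_T t)).
exists f; apply: functional_extensionality => xi; apply: cup_inj.
apply: eq_from_slice1 => [|i].
  by rewrite -[LHS]/(dim (T xi)) -[RHS]/(dim (Slide f xi)) hT dim_Slide.
rewrite -[size _]/(dim (T xi)) hT => i_lt.
(* Both slices at [i] equal the single sample [f (window i)]. *)
by rewrite -(Tw xi (Ordinal i_lt)) Tf -(Slide_slice1 _ _ _ f xi (Ordinal i_lt)).
Qed.

Theorem theorem2 (M N : Type) (c : nat) (hc : 0 < c) (T : cup c M -> cup 1 N) :
  (subsignal_compatible T <-> window_compatible T) /\
  (window_compatible T <-> exists! f : c.-tuple M -> N, T = Slide f).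
Proof.
split; split.
- exact: subsignal_compatible_window.
- exact: window_compatible_subsignal.
- move=> /window_compatible_exists_Slide[f Tf]; exists f; split=> // g Tg.
  by apply: Slide_inj; rewrite -Tf.
- by move=> [f [-> _]]; apply: window_compatible_Slide.
Qed.
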